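(* Let $G$ be a graph with $n$ vertices and $m\ge1$ edges, and put $X=2m+M_1-\frac{4m^2}{n}$. (i) If $n\le\frac{8m^2}{2m+M_1}$, then $$QE(G)\ \le\ \frac{2m}{n}+\sqrt{(n-1)\Big[X-\Big(\frac{2m}{n}\Big)^2\Big]},$$ with equality if and only if $G\cong K_n$, $G\cong\frac n2K_2$, or $G\cong S(n,r)$ for some $r$. (ii) If $n>\frac{8m^2}{2m+M_1}$, then $$QE(G)\ <\ \sqrt{\frac{X}{n}}+\sqrt{(n-1)\Big(X-\frac{X}{n}\Big)}.$$
   Context: All graphs are finite, simple and undirected. For a graph $G$ with $n$ vertices and $m$ edges, let $q_1\ge\cdots\ge q_n\ge0$ be the eigenvalues of the signless Laplacian $Q(G)=D(G)+A(G)$ ($D(G)$ the diagonal degree matrix, $A(G)$ the adjacency matrix). The signless Laplacian energy is $QE(G)=\sum_{i=1}^n|q_i-\frac{2m}{n}|$. $M_1=\sum_v d(v)^2$ is the first Zagreb index. $\frac n2K_2$ is the disjoint union of $\frac n2$ copies of $K_2$. A strongly regular graph with parameters $(n,r,a,c)$ is an $r$-regular graph on $n$ vertices in which any two adjacent vertices have exactly $a$ common neighbours and any two non-adjacent vertices have exactly $c$ common neighbours; $S(n,r)$ denotes a strongly regular graph with parameters $\big(n,r,\frac{r(r-1)}{n-1},\frac{r(r-1)}{n-1}\big)$. *)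

(* Defs.v *)
(* Graphs on vertex set 'I_n given by a symmetric irreflexive
   relation; spectra computed in algC (algebraically closed, so the
   characteristic polynomial splits). *)
From mathcomp Require Import all_boot all_order all_algebra algC.
Set Implicit Arguments.
Unset Strict Implicit.
Unset Printing Implicit Defensive.
Import Order.TTheory GRing.Theory Num.Theory.
Local Open Scope ring_scope.

Definition simple_graph (n : nat) (e : rel 'I_n) : Prop :=
  symmetric e /\ irreflexive e.

Definition edges (n : nat) (e : rel 'I_n) : {set {set 'I_n}} :=
  [set E : {set 'I_n} | [exists x, exists y, e x y && (E == [set x; y])]].

Definition nedges (n : nat) (e : rel 'I_n) : nat := #|edges e|.

Definition deg (n : nat) (e : rel 'I_n) (v : 'I_n) : nat := #|[set u | e v u]|.

Definition M1 (n : nat) (e : rel 'I_n) : nat := (\sum_(v < n) deg e v ^ 2)%N.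

Definition Qmat (n : nat) (e : rel 'I_n) : 'M[algC]_n :=
  \matrix_(i, j) ((i == j)%:R * (deg e i)%:R + (e i j)%:R).

(* the eigenvalues of Q, with multiplicity: the roots of its characteristic
   polynomial *)
Definition Qspec (n : nat) (e : rel 'I_n) : seq algC :=
  projT1 (closed_field_poly_normal (char_poly (Qmat e))).

Definition QE (n : nat) (e : rel 'I_n) : algC :=
  \sum_(q <- Qspec e) `|q - 2%:R * (nedges e)%:R / n%:R|.

Definition graph_iso (n n' : nat) (e : rel 'I_n) (e' : rel 'I_n') : Prop :=
  exists f : 'I_n -> 'I_n', bijective f /\ forall x y, e' (f x) (f y) = e x y.

Definition Kn (n : nat) : rel 'I_n := fun x y => x != y.

(* (n/2) K_2 on 'I_n (for n even): i ~ j iff i, j in the same pair {2k, 2k+1} *)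
Definition matchingK2 (n : nat) : rel 'I_n :=
  fun x y => (x != y) && (x./2 == y./2)%N.

Definition common_nb (n : nat) (e : rel 'I_n) (x y : 'I_n) : nat :=
  #|[set u | e x u && e y u]|.

Definition strongly_regular (n : nat) (e : rel 'I_n) (r a c : nat) : Prop :=
  (forall v, deg e v = r) /\
  (forall x y, x != y -> e x y -> common_nb e x y = a) /\
  (forall x y, x != y -> ~~ e x y -> common_nb e x y = c).

Definition is_S (n : nat) (e : rel 'I_n) (r : nat) : Prop :=
  exists a : nat, (a * (n - 1) = r * (r - 1))%N /\ strongly_regular e r a a.

(* Main.v *)
Require Import Defs.
From HB Require Import structures.
From mathcomp Require Import all_boot all_order all_algebra algC.
From mathcomp Require Import ring lra zify.
Set Implicit Arguments.
Unset Strict Implicit.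
Unset Printing Implicit Defensive.
Import Order.TTheory GRing.Theory Num.Theory.
Local Open Scope ring_scope.
Local Open Scope sesquilinear_scope.

(* Write t = 2m/n and x_i = q_i - t, so that sum x_i = 0 and sum x_i^2 = X. The
   Rayleigh quotient of the all-ones vector gives max x_i >= t, and Cauchy-Schwarz
   on the other x_i gives QE <= f(max x_i) with f(x) = x + sqrt((n-1)(X - x^2)).
   In case (i) t >= sqrt(X/n), where f is strictly decreasing, so QE <= f(t).
   Equality forces the all-ones vector to be an eigenvector, hence regularity, and
   forces all x_i but one to have the same square b, so A^2 = b I + c J: any two
   distinct vertices have the same number of common neighbours. K_n and (n/2) K_2
   are themselves of this kind (with r = n - 1 and r = 1), so only the third
   alternative of the equality case has to be treated.
   In case (ii) the right-hand side is sqrt(n X), the plain Cauchy-Schwarz bound,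
   and equality is excluded by the positive semidefiniteness of Q. *)

(** * Handshake identity *)

Lemma sum_deg (n : nat) (e : rel 'I_n) :
  simple_graph e -> (\sum_v deg e v)%N = (2 * nedges e)%N.
Proof.
move=> [symE irrE].
(* [edges] holds unordered pairs while [deg] counts neighbours; sending [u] to [[set v; u]] matches
   the neighbours of [v] with the edges through [v], which allows double counting. *)
have deg_edges v : deg e v = (\sum_(E in edges e) (v \in E))%N.
  rewrite -big_mkcondr sum1_card /deg.
  have inj : {in [set u | e v u] &, injective (fun u => [set v; u])}.
    move=> u w; rewrite !inE => evu evw eqE.
    have := set22 v u; rewrite eqE !inE => /orP[/eqP uv|/eqP //].
    by rewrite uv irrE in evu.
  rewrite -(card_in_imset inj); apply: eq_card => E; apply/imsetP/andP.
    case=> u; rewrite inE => evu ->; rewrite set21; split=> //.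
    by rewrite inE; apply/existsP; exists v; apply/existsP; exists u; rewrite evu /=.
  case; rewrite inE => /existsP[x /existsP[y /andP[exy /eqP ->]]].
  rewrite !inE => /orP[]/eqP ->; first by exists y; rewrite ?inE.
  by exists x; rewrite ?inE 1?symE // setUC.
rewrite (eq_bigr _ (fun v _ => deg_edges v)) exchange_big /= mulnC.
rewrite -[RHS]sum_nat_const; apply: eq_bigr => E.
rewrite inE => /existsP[x /existsP[y /andP[exy /eqP ->]]].
rewrite -big_mkcond sum1_card cards2; case: eqP exy => // ->.
by rewrite irrE.
Qed.

(** * Cauchy-Schwarz with its equality case, and a scalar inequality *)

Section CauchySchwarz.
Variables (R : realFieldType) (I : finType) (P : pred I) (x : I -> R).
Let k : R := #|P|%:R.
Let S := \sum_(i | P i) `|x i|.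
Let T := \sum_(i | P i) x i ^+ 2.

(** Variance identity: its left side is nonnegative, and vanishes only when all the norms agree.
    Scaling by [k] instead of dividing covers an empty [P] too. *)
Lemma sum_sqr_dev_norm :
  \sum_(i | P i) (k * `|x i| - S) ^+ 2 = k * (k * T - S ^+ 2).
Proof.
rewrite (eq_bigr (fun i => k ^+ 2 * x i ^+ 2 + ((- 2 * k * S) * `|x i| + S ^+ 2)));
  last first.
  by move=> i _; rewrite -(real_normK (num_real (x i))); ring.
rewrite !big_split /= -mulr_sumr -[X in _ + (X + _)]mulr_sumr sumr_const -[S ^+ 2 *+ _]mulr_natr.
rewrite -/S -/T -/k.
ring.
Qed.

Lemma sqr_sum_norm_le : S ^+ 2 <= k * T.
Proof.
have [P0|P_gt0] := posnP #|P|.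
  rewrite /S /T !big_pred0 ?expr0n ?mulr0 // => i; exact: (card0_eq P0).
have k_gt0 : 0 < k by rewrite ltr0n.
rewrite -subr_ge0 -(pmulr_rge0 _ k_gt0) -sum_sqr_dev_norm.
by apply: sumr_ge0 => i _; apply: sqr_ge0.
Qed.

Lemma sqr_sum_norm_eq : S ^+ 2 = k * T -> forall i, P i -> k * `|x i| = S.
Proof.
move=> eqST i Pi; have := sum_sqr_dev_norm; rewrite eqST subrr mulr0.
move/psumr_eq0P => /(_ (fun j _ => sqr_ge0 _))/(_ i Pi)/eqP.
by rewrite sqrf_eq0 subr_eq0 => /eqP.
Qed.

End CauchySchwarz.

(** Squared form of f(x) <= f(t), meant for [k] = n - 1. If [t < x], the bounds on [X] and [S] give
    [S < k * t], and the right side exceeds the left by at least 2(x - t)(kt - S) + (k - 1)(x -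
    t)^2. *)
Lemma shifted_sqr_le (R : realFieldType) (k t x S X : R) :
    1 <= k -> 0 <= t -> t <= x -> 0 <= S ->
    X <= (k + 1) * t ^+ 2 -> S ^+ 2 <= k * (X - x ^+ 2) ->
  (x - t + S) ^+ 2 <= k * (X - t ^+ 2) ?= iff (x == t) && (S ^+ 2 == k * (X - t ^+ 2)).
Proof.
move=> k_ge1 t_ge0 le_tx S_ge0 X_le S_le.
have k_gt0 : 0 < k by lra.
have x_ge0 : 0 <= x by lra.
have [xt|neq_xt] := eqVneq x t.
  move: S_le; rewrite xt => S_le.
  by rewrite subrr add0r; apply/leifP; case: eqP => // /eqP neqS; rewrite lt_neqAle neqS.
have lt_tx : t < x by rewrite lt_neqAle eq_sym neq_xt.
have lt_sqr : t ^+ 2 < x ^+ 2 by rewrite ltr_pXn2r ?nnegrE.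
have S_lt : S < k * t.
  rewrite -(ltr_pXn2r (isT : (0 < 2)%N)) ?nnegrE ?mulr_ge0 ?(ltW k_gt0) //.
  apply: le_lt_trans S_le _; rewrite exprMn [k ^+ 2]expr2 -mulrA (ltr_pM2l k_gt0).
  lra.
apply/leifP => /=.
have : 0 < (x - t) * (k * t - S) by rewrite mulr_gt0 ?subr_gt0.
have : 0 <= (x - t) ^+ 2 * (k - 1) by rewrite mulr_ge0 ?sqr_ge0 ?subr_ge0.
move: S_le; lra.
Qed.

(** * Unitary diagonalisation of Q and the moments of its spectrum *)

(** Eigenvalues are placed in [algR], a totally ordered field, so that real inequalities apply. For
    a simple graph Q is Hermitian, so the default of [insubd] never intervenes ([val_qeig]). *)
Definition qeig (n : nat) (e : rel 'I_n) (i : 'I_n) : algR :=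
  insubd (0 : algR) (spectral_diag (Qmat e) 0 i).

Lemma char_poly_conj (F : fieldType) (n : nat) (P A : 'M[F]_n) :
  P \in unitmx -> char_poly (invmx P *m A *m P) = char_poly A.
Proof.
move=> Pu; rewrite /char_poly.
have -> : char_poly_mx (invmx P *m A *m P)
    = map_mx polyC (invmx P) *m char_poly_mx A *m map_mx polyC P.
  rewrite /char_poly_mx mulmxBr mulmxBl !map_mxM; congr (_ - _).
  by rewrite mul_mx_scalar -scalemxAl -map_mxM mulVmx // map_mx1 scalemx1.
rewrite !det_mulmx mulrAC -det_mulmx -map_mxM mulVmx // map_mx1 det1 mul1r //.
Qed.

Section Spectrum.
Variables (n : nat) (e : rel 'I_n).
Hypothesis e_simple : simple_graph e.

Let Q := Qmat e.
Let U := spectralmx Q.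
Let d := qeig e.

Lemma Qmat_sym i j : Q i j = Q j i.
Proof.
rewrite !mxE (proj1 e_simple i j) eq_sym.
by case: eqP => [->|_]; rewrite ?mul0r.
Qed.

Lemma conj_Qmat i j : (Q i j)^* = Q i j.
Proof. by rewrite mxE -natrM -natrD conjC_nat. Qed.

Lemma Qmat_hermsym : Q \is hermsymmx.
Proof.
apply/is_hermitianmxP; rewrite expr0 scale1r; apply/matrixP => i j.
by rewrite [RHS]mxE [in RHS]mxE conj_Qmat Qmat_sym.
Qed.

Lemma val_qeig i : algRval (d i) = spectral_diag Q 0 i.
Proof.
rewrite /d /qeig val_insubd.
by have /mxOverP -> := hermitian_spectral_diag_real Qmat_hermsym.
Qed.

Lemma Qmat_spectral : Q = U ^t* *m diag_mx (spectral_diag Q) *m U.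
Proof.
rewrite -invmx_unitary ?spectral_unitarymx //.
exact/orthomx_spectralP/hermitian_normalmx/Qmat_hermsym.
Qed.

Lemma spectralmx_orthonormal_col j k :
  \sum_i (U i j)^* * U i k = (j == k)%:R.
Proof.
have /unitarymxP/mulmx1C/matrixP/(_ j k) := spectral_unitarymx Q.
by rewrite !mxE => <-; apply: eq_bigr => i _; rewrite !mxE.
Qed.

Lemma spectralmx_orthonormal_row i j : \sum_k U i k * (U j k)^* = (i == j)%:R.
Proof.
have /unitarymxP/matrixP/(_ i j) := spectral_unitarymx Q.
by rewrite !mxE => <-; apply: eq_bigr => k _; rewrite !mxE.
Qed.

Lemma Qmat_entry j k : Q j k = \sum_i (U i j)^* * algRval (d i) * U i k.
Proof.
rewrite {1}Qmat_spectral mxE; apply: eq_bigr => i _.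
by rewrite mul_mx_diag !mxE val_qeig.
Qed.

Lemma spectralmx_Qmat i j : \sum_k U i k * Q k j = algRval (d i) * U i j.
Proof.
have := spectral_unitarymx Q; rewrite -/U => /unitarymxP Uu.
have : U *m Q = diag_mx (spectral_diag Q) *m U.
  by rewrite {1}Qmat_spectral !mulmxA Uu mul1mx.
by move=> /matrixP/(_ i j); rewrite mul_diag_mx !mxE val_qeig.
Qed.

(** Both lists split the characteristic polynomial of Q into monic linear factors, and such a
    splitting is unique up to order. *)
Lemma Qspec_qeig : perm_eq (Qspec e) [seq algRval (d i) | i <- enum 'I_n].
Proof.
apply: prod_XsubC_eq; rewrite /Qspec; case: closed_field_poly_normal => s /= sE.
have -> : \prod_(x <- s) ('X - x%:P) = char_poly Q.
  by rewrite [RHS]sE (monicP (char_poly_monic Q)) scale1r.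
rewrite big_map big_enum /= Qmat_spectral -invmx_unitary ?spectral_unitarymx //.
rewrite char_poly_conj ?spectral_unit // char_poly_trig; last exact: diag_mx_is_trig.
by apply: eq_bigr => i _; rewrite val_qeig mxE eqxx.
Qed.

Lemma QE_qeig :
  QE e = algRval (\sum_i `|d i - 2 * (nedges e)%:R / n%:R|).
Proof.
rewrite /QE (perm_big _ Qspec_qeig) big_map big_enum /= rmorph_sum.
apply: eq_bigr => i _.
have -> : 2 * (nedges e)%:R / n%:R = algRval (2 * (nedges e)%:R / n%:R).
  by rewrite fmorph_div rmorphM !rmorph_nat.
by rewrite -rmorphB.
Qed.

Lemma mxtrace_Qmat : \tr Q = (2 * nedges e)%:R.
Proof.
rewrite -sum_deg // natr_sum; apply: eq_bigr => i _.
by rewrite mxE eqxx mul1r (proj2 e_simple) addr0.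
Qed.

Lemma sum_qeig : \sum_i d i = (2 * nedges e)%:R.
Proof.
apply: (fmorph_inj algRval); rewrite rmorph_nat -mxtrace_Qmat rmorph_sum.
rewrite /mxtrace [RHS](eq_bigr _ (fun j _ => Qmat_entry j j)) exchange_big /=.
apply: eq_bigr => i _.
rewrite (eq_bigr (fun j => algRval (d i) * (U i j * (U i j)^*))).
  by rewrite -mulr_sumr spectralmx_orthonormal_row eqxx mulr1.
by move=> j _; ring.
Qed.

Lemma sum_adj i : \sum_j (e i j)%:R = (deg e i)%:R :> algC.
Proof.
rewrite /deg cardsE -sum1_card natr_sum [RHS]big_mkcond /=.
by apply: eq_bigr => j _; rewrite unfold_in; case: e.
Qed.

Lemma sum_Qmat_row i : \sum_j Q i j = 2 * (deg e i)%:R.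
Proof.
under eq_bigr do rewrite mxE.
rewrite big_split /= sum_adj (bigD1 i) //= eqxx mul1r big1 ?addr0; first by ring.
by move=> j; rewrite eq_sym => /negPf ->; rewrite mul0r.
Qed.

(** Row [i] has [deg e i] on the diagonal and, off it, exactly [deg e i] ones. *)
Lemma sum_sqr_Qmat : \sum_i \sum_j Q i j ^+ 2 = (2 * nedges e + M1 e)%:R.
Proof.
rewrite natrD -sum_deg // /M1 !natr_sum -big_split /=; apply: eq_bigr => i _.
rewrite -sum_adj natrX addrC (bigD1 i) //= [in RHS](bigD1 i) //= addrA.
rewrite mxE eqxx (proj2 e_simple) !addr0 mul1r; congr (_ + _).
apply: eq_bigr => j; rewrite mxE eq_sym => /negPf ->.
by case: e; rewrite mul0r add0r ?expr1n ?expr0n.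
Qed.

Lemma sum_sqr_qeig : \sum_i d i ^+ 2 = (2 * nedges e + M1 e)%:R.
Proof.
apply: (fmorph_inj algRval); rewrite rmorph_nat -sum_sqr_Qmat rmorph_sum.
(* One factor of each squared entry is expanded spectrally; the other is absorbed by the eigenvector
   equation [spectralmx_Qmat]. *)
under [RHS]eq_bigr => j _ do under eq_bigr => k _ do
  rewrite expr2 [X in X * _]Qmat_entry mulr_suml.
under [RHS]eq_bigr do rewrite exchange_big.
rewrite exchange_big /=; apply: eq_bigr => i _.
have sumE j : \sum_k (U i j)^* * algRval (d i) * U i k * Q j k
    = algRval (d i) ^+ 2 * (U i j * (U i j)^*).
  have -> : algRval (d i) ^+ 2 * (U i j * (U i j)^*)
      = (U i j)^* * algRval (d i) * (algRval (d i) * U i j) by ring.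
  rewrite -spectralmx_Qmat mulr_sumr.
  by apply: eq_bigr => k _; rewrite (Qmat_sym k j) mulrA.
under [RHS]eq_bigr do rewrite sumE.
by rewrite -mulr_sumr spectralmx_orthonormal_row eqxx mulr1 rmorphXn.
Qed.

(** Adding the form to its copy with [j] and [k] exchanged completes the squares. Each edge occurs
    as two ordered pairs, hence the factor 2. *)
Lemma Qmat_quadratic_form (u : 'I_n -> algC) :
  2 * (\sum_j \sum_k u j * Q j k * (u k)^*)
    = \sum_j \sum_k (e j k)%:R * `|u j + u k| ^+ 2.
Proof.
have qE : \sum_j \sum_k u j * Q j k * (u k)^*
    = \sum_j \sum_k (e j k)%:R * (u j * (u j)^* + u j * (u k)^*).
  apply: eq_bigr => j _.
  under eq_bigr do rewrite mxE mulrDr mulrDl.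
  under [RHS]eq_bigr do rewrite mulrDr.
  rewrite !big_split /= -mulr_suml sum_adj; congr (_ + _).
    rewrite (bigD1 j) //= eqxx mul1r big1 ?addr0; first by ring.
    by move=> k; rewrite eq_sym => /negPf ->; rewrite mul0r mulr0 mul0r.
  by apply: eq_bigr => k _; ring.
rewrite mulr_natl mulr2n {1}qE {}qE [X in X + _]exchange_big -big_split /=.
apply: eq_bigr => j _; rewrite -big_split /=; apply: eq_bigr => k _.
rewrite (proj1 e_simple k j) normCK rmorphD /=; ring.
Qed.

Lemma qeig_ge0 i : 0 <= d i.
Proof.
suff : 0 <= 2 * algRval (d i) by rewrite pmulr_rge0 // ltr0n.
(* Row [i] of [U] is a unit left eigenvector, so the form takes the value [d i] there. *)
have -> : algRval (d i) = \sum_j \sum_k U i j * Q j k * (U i k)^*.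
  rewrite exchange_big /=; under eq_bigr do rewrite -mulr_suml spectralmx_Qmat -mulrA.
  by rewrite -mulr_sumr spectralmx_orthonormal_row eqxx mulr1.
rewrite Qmat_quadratic_form; apply: sumr_ge0 => j _; apply: sumr_ge0 => k _.
by rewrite mulr_ge0 ?ler0n // exprn_ge0.
Qed.

End Spectrum.

(** * Rayleigh quotient of the all-ones vector *)

Section Rayleigh.
Variables (n : nat) (e : rel 'I_n).
Hypothesis e_simple : simple_graph e.

Let U := spectralmx (Qmat e).
(** Coordinates of the all-ones vector in the eigenbasis. *)
Let y i := \sum_k U i k.

Let sum_normy : \sum_i `|y i| ^+ 2 = n%:R.
Proof.
under eq_bigr => i _ do rewrite normCK mulrC {1}/y rmorph_sum mulr_suml.
rewrite exchange_big /= (eq_bigr (fun=> 1)) ?sumr_const ?card_ord // => j _.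
under eq_bigr do rewrite mulr_sumr.
rewrite exchange_big /= (eq_bigr (fun k => (j == k)%:R)); last first.
  by move=> k _; rewrite spectralmx_orthonormal_col.
by rewrite (bigD1 j) //= eqxx big1 ?addr0 // => k; rewrite eq_sym => /negPf ->.
Qed.

Let row_sum j : 2 * (deg e j)%:R = \sum_i (U i j)^* * algRval (qeig e i) * y i.
Proof.
rewrite -sum_Qmat_row //; under eq_bigr do rewrite Qmat_entry //.
by rewrite exchange_big; apply: eq_bigr => i _; rewrite -mulr_sumr.
Qed.

Let sum_normy_qeig :
  \sum_i algRval (qeig e i) * `|y i| ^+ 2 = (4 * nedges e)%:R.
Proof.
rewrite -[4%N]/(2 * 2)%N -mulnA -sum_deg // natrM natr_sum mulr_sumr.
under [RHS]eq_bigr do rewrite row_sum.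
rewrite exchange_big; apply: eq_bigr => i _ /=.
by rewrite -!mulr_suml -rmorph_sum -/(y i) normCK; ring.
Qed.

(* The witness maximizes [qeig e]; the bound is the Rayleigh quotient of the
   all-ones vector, which is an eigenvector in the equality case. *)
Lemma qeig_max_ge : (0 < n)%N ->
  exists2 i0, 4 * (nedges e)%:R / n%:R <= qeig e i0
    & qeig e i0 = 4 * (nedges e)%:R / n%:R ->
      forall v, 2 * (deg e v)%:R = qeig e i0.
Proof.
move=> n_gt0; pose i00 := Ordinal n_gt0.
have [i0 _ i0_max] := Order.TotalTheory.arg_maxP (qeig e) (isT : xpredT i00).
pose w i : algR := in_algR (normr_real (y i)) ^+ 2.
have w_ge0 i : 0 <= w i by rewrite sqr_ge0.
have wE i : algRval (w i) = `|y i| ^+ 2 by rewrite rmorphXn.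
(* The weights [w i] sum to n and the form at the all-ones vector is 4m, so the Rayleigh gap is a
   sum of nonnegative terms. *)
have gapE : \sum_i w i * (qeig e i0 - qeig e i)
    = n%:R * qeig e i0 - 4 * (nedges e)%:R.
  apply: (fmorph_inj algRval); rewrite rmorph_sum rmorphB !rmorphM !rmorph_nat.
  rewrite -natrM -sum_normy_qeig -sum_normy mulr_suml -sumrB; apply: eq_bigr => i _.
  by rewrite rmorphM rmorphB /=; ring.
have term_ge0 i : true -> 0 <= w i * (qeig e i0 - qeig e i).
  by move=> _; rewrite mulr_ge0 // subr_ge0; apply: i0_max.
have nR_gt0 : 0 < n%:R :> algR by rewrite ltr0n.
exists i0.
  by rewrite ler_pdivrMr // [leRHS]mulrC -subr_ge0 -gapE sumr_ge0.
move=> eq_i0 v; apply: (fmorph_inj algRval); rewrite rmorphM !rmorph_nat row_sum.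
(* A zero gap leaves the all-ones vector no component outside the top eigenspace. *)
have termE i : algRval (qeig e i) * y i = algRval (qeig e i0) * y i.
  have : \sum_i w i * (qeig e i0 - qeig e i) = 0.
    by rewrite gapE eq_i0 mulrCA divff ?gt_eqF // mulr1 subrr.
  move/(psumr_eq0P term_ge0)/(_ i isT)/eqP; rewrite mulf_eq0 subr_eq0.
  case/orP=> [/eqP w0|/eqP ->] //.
  have /eqP := wE i; rewrite w0 rmorph0 eq_sym sqrf_eq0 normr_eq0 => /eqP ->.
  by rewrite !mulr0.
under eq_bigr do rewrite -mulrA termE /y 2!mulr_sumr.
rewrite exchange_big /= (eq_bigr (fun k => algRval (qeig e i0) * (v == k)%:R)).
  rewrite -mulr_sumr (bigD1 v) //= eqxx big1 ?addr0 ?mulr1 // => k.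
  by rewrite eq_sym => /negPf ->.
move=> k _; rewrite -(spectralmx_orthonormal_col e) mulr_sumr.
by apply: eq_bigr => i _; rewrite -/U; ring.
Qed.

End Rayleigh.

(* Locked: otherwise [/=] computes the subtraction under [algRval]. *)
HB.lock Definition qdev (n : nat) (e : rel 'I_n) (t : algR) (i : 'I_n) : algR :=
  qeig e i - t.

Lemma qdevE (n : nat) (e : rel 'I_n) (t : algR) i : qdev e t i = qeig e i - t.
Proof. by rewrite qdev.unlock. Qed.

(** * Regular graphs: adjacency spectrum and common neighbours as entries of A^2 *)

Section Regular.
Variables (n : nat) (e : rel 'I_n) (r : nat).
Hypotheses (e_simple : simple_graph e) (e_reg : forall v, deg e v = r).

Let U := spectralmx (Qmat e).
Local Notation mu := (qdev e r%:R).

Lemma regular_nedges : (2 * nedges e)%N = (n * r)%N.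
Proof.
by rewrite -sum_deg // (eq_bigr _ (fun v _ => e_reg v)) sum_nat_const card_ord.
Qed.

Lemma regular_M1 : M1 e = (n * r ^ 2)%N.
Proof.
by rewrite /M1 (eq_bigr (fun=> r ^ 2)%N) ?sum_nat_const ?card_ord // => v _; rewrite e_reg.
Qed.

Lemma regular_adjE j k : (e j k)%:R = Qmat e j k - (j == k)%:R * r%:R.
Proof. by rewrite mxE e_reg; ring. Qed.

Let val_mu i : algRval (mu i) = algRval (qeig e i) - r%:R.
Proof. by rewrite qdevE rmorphB rmorph_nat. Qed.

(** Since A = Q - rI, the rows of [U] diagonalise A as well, and [mu] lists the adjacency
    eigenvalues. *)
Lemma spectralmx_adj i j : \sum_k U i k * (e k j)%:R = algRval (mu i) * U i j.
Proof.
rewrite val_mu; under eq_bigr do rewrite regular_adjE mulrBr.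
rewrite sumrB spectralmx_Qmat // (bigD1 j) //= eqxx mul1r big1 ?addr0; last first.
  by move=> k /negPf ->; rewrite mul0r mulr0.
by rewrite -/U; ring.
Qed.

Lemma adj_entry j k : (e j k)%:R = \sum_i (U i j)^* * algRval (mu i) * U i k.
Proof.
rewrite regular_adjE Qmat_entry // -(spectralmx_orthonormal_col e) mulr_suml -sumrB.
by apply: eq_bigr => i _; rewrite val_mu -/U; ring.
Qed.

Lemma sum_adj_mul j k : \sum_l (e j l)%:R * (e l k)%:R = (common_nb e j k)%:R :> algC.
Proof.
rewrite /common_nb cardsE -sum1_card natr_sum [RHS]big_mkcond /=.
apply: eq_bigr => l _; rewrite unfold_in (proj1 e_simple l k).
by case: (e j l); case: (e k l); rewrite ?mulr1 ?mulr0 ?mul0r.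
Qed.

Lemma common_nb_spectral j k :
  (common_nb e j k)%:R = \sum_i (U i j)^* * algRval (mu i) ^+ 2 * U i k.
Proof.
rewrite -sum_adj_mul; under eq_bigr do rewrite adj_entry mulr_suml.
rewrite exchange_big; apply: eq_bigr => i _.
transitivity ((U i j)^* * algRval (mu i) * (algRval (mu i) * U i k));
  last by rewrite /U; ring.
by rewrite -spectralmx_adj mulr_sumr; apply: eq_bigr => l _; rewrite mulrA.
Qed.

Lemma sum_common_nb j : (\sum_k common_nb e j k = r * r)%N.
Proof.
apply/eqP; rewrite -(eqr_nat algC) natr_sum; apply/eqP.
under eq_bigr do rewrite -sum_adj_mul.
rewrite exchange_big /=.
under eq_bigr => l _.
  rewrite -mulr_sumr sum_adj e_reg; over.
by rewrite -mulr_suml sum_adj e_reg natrM.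
Qed.

Lemma common_nb_diag j : common_nb e j j = r.
Proof. by rewrite -(e_reg j) /common_nb /deg; apply: eq_card => u; rewrite !inE andbb. Qed.

(** Here A^2 = bI + cP with c = r^2 - b and P the rank-one projector given by row [i0] of [U]. All
    row sums of A^2 are r^2, so unless c = 0 that row is constant; either way the off-diagonal
    entries of A^2 coincide. *)
Lemma flat_spectrum_is_S (i0 : 'I_n) (b : algR) :
    (0 < nedges e)%N -> mu i0 = r%:R -> (forall i, i != i0 -> mu i ^+ 2 = b) ->
  is_S e r.
Proof.
move=> m_gt0 mu0 mub.
pose c := algRval (r%:R ^+ 2 - b).
have nbE j k : (common_nb e j k)%:R
    = algRval b * (j == k)%:R + c * ((U i0 j)^* * U i0 k).
  rewrite common_nb_spectral -(spectralmx_orthonormal_col e) mulr_sumr.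
  rewrite (bigD1 i0) //= [in RHS](bigD1 i0) //= mu0.
  rewrite (eq_bigr (fun i => algRval b * ((U i j)^* * U i k))); last first.
    by move=> i ii0; rewrite -(mub i ii0) rmorphXn /=; ring.
  by rewrite /c rmorphB rmorphXn !rmorph_nat /= -/U; ring.
have colE j : c * ((U i0 j)^* * \sum_k U i0 k) = c.
  have : (\sum_k common_nb e j k)%:R = (r * r)%:R :> algC by rewrite sum_common_nb.
  rewrite natr_sum; under eq_bigr do rewrite nbE.
  rewrite big_split /= -!mulr_sumr (bigD1 j) //= eqxx big1 ?addr0; last first.
    by move=> k; rewrite eq_sym => /negPf ->.
  rewrite mulr1 natrM => sumE; apply: (addrI (algRval b)).
  by rewrite sumE /c rmorphB rmorphXn rmorph_nat /=; ring.
have offE j k j' k' : j != k -> j' != k' -> common_nb e j k = common_nb e j' k'.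
  move=> /negPf jk /negPf jk'; apply/eqP; rewrite -(eqr_nat algC) !nbE jk jk'.
  have [->|c_neq0] := eqVneq c 0; first by rewrite !mul0r.
  have conjE l : (U i0 l)^* * (\sum_k U i0 k) = 1.
    by apply: (mulfI c_neq0); rewrite colE mulr1.
  have s_neq0 : \sum_k U i0 k != 0.
    by apply/eqP => s0; have /eqP := conjE i0; rewrite s0 mulr0 eq_sym oner_eq0.
  have U_const l l' : (U i0 l)^* = (U i0 l')^*.
    by apply: (mulIf s_neq0); rewrite !conjE.
  by rewrite (U_const j j') -[U i0 k]conjCK (U_const k k') conjCK.
(* An edge provides two distinct vertices, whose common-neighbour count serves as the parameter
   [a]. *)
have [x [z exz]] : exists x z, e x z.
  move: m_gt0; rewrite /nedges card_gt0 => /set0Pn[E].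
  by rewrite inE => /existsP[x /existsP[z /andP[exz _]]]; exists x, z.
have xz : x != z by apply: contraTneq exz => ->; rewrite (proj2 e_simple).
exists (common_nb e x z); split; last first.
  by split=> //; split=> j k jk _; apply: offE.
(* The row sum of A^2 at [x] reads r + (n - 1)a = r^2. *)
have := sum_common_nb x; rewrite (bigD1 x) //= common_nb_diag.
rewrite (eq_bigr (fun=> common_nb e x z));
  last by move=> k; rewrite eq_sym => xk; apply: offE.
rewrite sum_nat_const cardC1 card_ord subn1 => rE.
by rewrite mulnBr muln1 -rE addKn mulnC.
Qed.

(** The hypothesis says A^2 = (r - a)I + aJ. An eigenvector whose eigenvalue differs from r has
    coordinate sum 0, because A fixes the all-ones vector up to the factor r; hence J annihilates
    it. *)
Lemma is_S_qeig (a : nat) :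
    (forall x y, x != y -> common_nb e x y = a) ->
  forall i, mu i ^+ 2 = r%:R - a%:R \/ mu i = r%:R.
Proof.
move=> nb_a i; have [->|mu_r] := eqVneq (mu i) r%:R; [by right|left].
have s0 : \sum_k U i k = 0.
  have : algRval (mu i) * \sum_k U i k = r%:R * \sum_k U i k.
    rewrite mulr_sumr; under eq_bigr do rewrite -spectralmx_adj.
    rewrite exchange_big /= mulr_sumr; apply: eq_bigr => k _.
    by rewrite -mulr_sumr sum_adj e_reg mulrC.
  move/eqP; rewrite -subr_eq0 -mulrBl mulf_eq0 -(rmorph_nat algRval) -rmorphB.
  by rewrite fmorph_eq0 subr_eq0 (negPf mu_r) => /eqP.
have muU j : algRval (mu i) ^+ 2 * U i j = algRval (r%:R - a%:R) * U i j.
  transitivity (\sum_k U i k * (common_nb e k j)%:R).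
    under [RHS]eq_bigr do rewrite -sum_adj_mul mulr_sumr.
    rewrite exchange_big expr2 -mulrA -spectralmx_adj mulr_sumr; apply: eq_bigr => l _.
    rewrite mulrA -spectralmx_adj mulr_suml.
    by apply: eq_bigr => k _; rewrite mulrA.
  transitivity (\sum_k (a%:R * U i k + (k == j)%:R * (algRval (r%:R - a%:R) * U i k))).
    apply: eq_bigr => k _; rewrite rmorphB !rmorph_nat /=.
    case: eqVneq => [->|kj]; first by rewrite common_nb_diag [true%:R]mulr1n; ring.
    by rewrite nb_a // [false%:R]mulr0n; ring.
  rewrite big_split /= -mulr_sumr s0 mulr0 add0r (bigD1 j) //= eqxx mul1r big1 ?addr0 //.
  by move=> k /negPf ->; rewrite mul0r.
apply/eqP; apply: contraT => neq.
have U0 k : U i k = 0.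
  apply/eqP; have /eqP := muU k; rewrite -subr_eq0 -mulrBl -rmorphXn -rmorphB mulf_eq0.
  by rewrite fmorph_eq0 subr_eq0 (negPf neq).
have := spectralmx_orthonormal_row e i i; rewrite big1 ?eqxx.
  by move/eqP; rewrite eq_sym oner_eq0.
by move=> k _; rewrite -/U U0 mul0r.
Qed.

End Regular.

(** * Isomorphism invariance, and the two explicit graphs as instances of S(n, r) *)

Lemma is_S_iso (n : nat) (e e' : rel 'I_n) (r : nat) :
  graph_iso e e' -> is_S e' r -> is_S e r.
Proof.
move=> [f [f_bij f_adj]] [a [arE [e'_deg [e'_adj e'_nadj]]]].
have nbE x z : common_nb e x z = common_nb e' (f x) (f z).
  rewrite /common_nb -!sum1dep_card [RHS](reindex f) /=; last exact: onW_bij.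
  by apply: eq_bigl => u; rewrite !f_adj.
have f_neq x z : x != z -> f x != f z by rewrite (inj_eq (bij_inj f_bij)).
exists a; split=> //; split; last split=> x z xz.
- move=> v; rewrite -(e'_deg (f v)) /deg -!sum1dep_card [RHS](reindex f) /=;
    last exact: onW_bij.
  by apply: eq_bigl => u; rewrite f_adj.
- by rewrite nbE -(f_adj x z); apply: e'_adj; apply: f_neq.
- by rewrite nbE -(f_adj x z); apply: e'_nadj; apply: f_neq.
Qed.

Lemma Kn_is_S (n : nat) : is_S (@Kn n) (n - 1).
Proof.
have nbE x z : x != z -> common_nb (@Kn n) x z = (n - 2)%N.
  move=> xz; rewrite /common_nb (_ : [set u | _] = ~: [set x; z]).
    by rewrite cardsCs setCK card_ord cards2 xz.
  by apply/setP => u; rewrite !inE negb_or /Kn ![u == _]eq_sym.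
exists (n - 2)%N; split; first by rewrite mulnC -subnDA.
split; last by split=> x z xz _; apply: nbE.
move=> v; rewrite /deg (_ : [set u | _] = [set~ v]); last first.
  by apply/setP => u; rewrite !inE /Kn eq_sym.
by rewrite cardsC1 card_ord subn1.
Qed.

Lemma matchingK2_is_S (n : nat) : ~~ odd n -> is_S (@matchingK2 n) 1.
Proof.
move=> n_even.
have nbE x z : x != z -> common_nb (@matchingK2 n) x z = 0%N.
  move=> xz; apply: eq_card0 => u; rewrite inE; apply/negP.
  by move: xz; rewrite /matchingK2 -!val_eqE /=; lia.
exists 0%N; split=> //; split; last by split=> x z xz _; apply: nbE.
(* The partner of [v] in its pair; evenness of n keeps it in range. *)
move=> v; have p_lt : ((if odd v then v.-1 else v.+1) < n)%N.
  by have := ltn_ord v; case: ifP; lia.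
rewrite /deg (_ : [set u | _] = [set Ordinal p_lt]) ?cards1 //.
apply/setP => u; rewrite !inE /matchingK2 -!val_eqE /=.
by case: ifP; lia.
Qed.

(** Turns comparisons with [sqrtC] into squared ones in [algR]. *)
Lemma algRval_sqr_sqrtC (x y : algR) : 0 <= x ->
  (x ^+ 2 <= y -> algRval x <= sqrtC (algRval y)) /\
  (algRval x = sqrtC (algRval y) <-> x ^+ 2 = y).
Proof.
move=> x_ge0; have xE : algRval x = sqrtC (algRval (x ^+ 2)).
  by rewrite rmorphXn sqrCK.
split=> [le_xy|].
  have y_ge0 : 0 <= y by apply: le_trans (sqr_ge0 _) le_xy.
  by rewrite xE ler_sqrtC // qualifE /= ?sqr_ge0 //; apply: (sqr_ge0 x).
split=> [xy|<-] //; apply: (fmorph_inj algRval).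
by rewrite rmorphXn /= xy sqrtCK.
Qed.

(** * Energy bounds for the centred eigenvalues, over [algR] *)

Section EnergyBounds.
Variables (n : nat) (e : rel 'I_n).
Hypotheses (e_simple : simple_graph e) (m_gt0 : (0 < nedges e)%N).

Let N : algR := n%:R.
Let m : algR := (nedges e)%:R.
Let t : algR := 2 * m / N.
Let X : algR := 2 * m + (M1 e)%:R - 4 * m ^+ 2 / N.
Let x := qdev e t.
Let E := \sum_i `|x i|.

Lemma vertices_gt1 : (1 < n)%N.
Proof.
move: m_gt0; rewrite /nedges card_gt0 => /set0Pn[F].
rewrite inE => /existsP[u /existsP[v /andP[euv _]]].
have : u != v by apply: contraTneq euv => ->; rewrite (proj2 e_simple).
by rewrite -val_eqE /=; have := ltn_ord u; have := ltn_ord v; lia.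
Qed.

Let N_gt0 : 0 < N.
Proof. by rewrite ltr0n (ltn_trans _ vertices_gt1). Qed.

Let t_gt0 : 0 < t.
Proof. by rewrite divr_gt0 // mulr_gt0 ?ltr0n. Qed.

Let NtE : N * t = 2 * m.
Proof. by rewrite /t mulrCA divff ?gt_eqF // mulr1. Qed.

Lemma sum_qdev : \sum_i x i = 0.
Proof.
under eq_bigr do rewrite /x qdevE.
rewrite sumrB sum_qeig // sumr_const card_ord -[t *+ n]mulr_natl -/N NtE natrM -/m; ring.
Qed.

Lemma sum_sqr_qdev : \sum_i x i ^+ 2 = X.
Proof.
rewrite (eq_bigr (fun i => qeig e i ^+ 2 + ((- 2 * t) * qeig e i + t ^+ 2))); last first.
  by move=> i _; rewrite /x qdevE; ring.
rewrite !big_split /= -mulr_sumr sum_qeig // sum_sqr_qeig // sumr_const card_ord.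
rewrite -[t ^+ 2 *+ n]mulr_natl -/N natrD !natrM -/m /X /t; field.
by rewrite gt_eqF.
Qed.

Lemma sqr_energy_le : E ^+ 2 <= N * X.
Proof.
have := sqr_sum_norm_le predT x.
by rewrite -/E sum_sqr_qdev cardT size_enum_ord.
Qed.

(* If every |q_i - t| equals sqrt(X/n) > t then q_i >= 0 forces q_i > t for all i,
   contradicting that t is the mean of the q_i. *)
Lemma sqr_energy_lt : N * t ^+ 2 < X -> E ^+ 2 < N * X.
Proof.
move=> lt_X; rewrite lt_neqAle sqr_energy_le andbT; apply/eqP => eqE.
have normE i : N * `|x i| = E.
  have := @sqr_sum_norm_eq _ _ predT x; rewrite -/E sum_sqr_qdev cardT size_enum_ord.
  by move=> /(_ eqE i isT).
have x_gt i : t < x i.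
  have lt_norm : t < `|x i|.
    rewrite -(ltr_pM2l N_gt0) normE -(ltr_pXn2r (isT : (0 < 2)%N)) ?nnegrE.
    + by rewrite eqE exprMn [N ^+ 2]expr2 -mulrA ltr_pM2l.
    + by rewrite mulr_ge0 ?ltW.
    + by apply: sumr_ge0.
  move: lt_norm; case: (lerP 0 (x i)) => [x_ge0|x_lt0]; first by rewrite ger0_norm.
  rewrite ltr0_norm // {1}/x qdevE => lt_t.
  by have := qeig_ge0 e_simple i; move: t_gt0; lra.
have i0 : 'I_n by exists 0%N; apply: ltnW vertices_gt1.
have : \sum_i x i > 0.
  rewrite (bigD1 i0) //= ltr_wpDr ?(lt_trans t_gt0) //.
  by apply: sumr_ge0 => i _; rewrite ltW ?(lt_trans t_gt0).
by rewrite sum_qdev ltxx.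
Qed.

Let sum_off (i0 : 'I_n) : \sum_(i | i != i0) x i ^+ 2 = X - x i0 ^+ 2.
Proof. by rewrite -sum_sqr_qdev [in RHS](bigD1 i0) //= addrAC subrr add0r. Qed.

Let card_off (i0 : 'I_n) : #|predC1 i0|%:R = N - 1 :> algR.
Proof. by rewrite cardC1 card_ord -subn1 natrB // ltnW // vertices_gt1. Qed.

(** Centred form of [qeig_max_ge]: since 4m/n = 2t, subtracting the mean leaves the bound t. *)
Lemma max_qdev : exists2 i0, t <= x i0 & x i0 = t -> forall v, (deg e v)%:R = t.
Proof.
have [i0 ge_i0 eq_i0] := qeig_max_ge e_simple (ltnW vertices_gt1).
have t2E : 4 * (nedges e)%:R / n%:R = 2 * t :> algR.
  by rewrite /t -/m -/N; field; rewrite gt_eqF.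
exists i0; rewrite /x qdevE; first by move: ge_i0; rewrite t2E; lra.
move=> x_i0 v; have q_i0 : qeig e i0 = 2 * t by move: x_i0; lra.
by have := eq_i0 (etrans q_i0 (esym t2E)) v; rewrite q_i0; lra.
Qed.

Let E_split (i0 : 'I_n) : t <= x i0 ->
  E - t = x i0 - t + \sum_(i | i != i0) `|x i|.
Proof.
by move=> ge_t; rewrite /E (bigD1 i0) //= ger0_norm ?(le_trans (ltW t_gt0)) // addrAC.
Qed.

Lemma energy_ge_mean : 0 <= E - t.
Proof.
have [i0 ge_t _] := max_qdev.
by rewrite (E_split ge_t) addr_ge0 ?subr_ge0 // sumr_ge0.
Qed.

Lemma energy_sub_mean_leif (i0 : 'I_n) : X <= N * t ^+ 2 -> t <= x i0 ->
  (E - t) ^+ 2 <= (N - 1) * (X - t ^+ 2)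
    ?= iff (x i0 == t) && ((\sum_(i | i != i0) `|x i|) ^+ 2 == (N - 1) * (X - t ^+ 2)).
Proof.
move=> X_le ge_t; rewrite (E_split ge_t); apply: shifted_sqr_le => //.
- by rewrite lerBrDr -[1 + 1]/(2%:R) ler_nat vertices_gt1.
- exact: ltW.
- by rewrite sumr_ge0.
- by rewrite subrK.
- by rewrite -(card_off i0) -sum_off; apply: sqr_sum_norm_le.
Qed.

Lemma energy_sub_mean_le : X <= N * t ^+ 2 -> (E - t) ^+ 2 <= (N - 1) * (X - t ^+ 2).
Proof.
by move=> X_le; have [i0 ge_t _] := max_qdev; have [] := energy_sub_mean_leif X_le ge_t.
Qed.

Lemma energy_eq_is_S : X <= N * t ^+ 2 ->
  (E - t) ^+ 2 = (N - 1) * (X - t ^+ 2) -> exists r, is_S e r.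
Proof.
move=> X_le /eqP; have [i0 ge_t reg] := max_qdev.
rewrite (energy_sub_mean_leif X_le ge_t) => /andP[/eqP x_i0 /eqP S2E].
have [v _] : exists v : 'I_n, true by exists i0.
have degE w : (deg e w)%:R = t by apply: reg.
have deg_const w : deg e w = deg e v by apply/eqP; rewrite -(eqr_nat algR) !degE.
exists (deg e v); pose S := \sum_(i | i != i0) `|x i|.
(* Equality in Cauchy-Schwarz off [i0] gives each remaining norm the value S/(N - 1), which explains
   this choice of b. *)
apply: (@flat_spectrum_is_S _ _ _ e_simple deg_const i0 ((S / (N - 1)) ^+ 2)) => //.
  by rewrite degE -/x x_i0.
move=> i ii0; rewrite degE -/x -real_normK ?num_real //; congr (_ ^+ 2).
have := @sqr_sum_norm_eq _ _ (predC1 i0) x; rewrite card_off sum_off x_i0 => /(_ S2E i ii0).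
rewrite -/S => <-; rewrite mulrAC divff ?mul1r // subr_eq0 -[1]/(1%:R) eqr_nat.
by rewrite gtn_eqF // vertices_gt1.
Qed.

(** Each x_i^2 is b = t - a or t^2, with b <= t^2. The excess of the squares over b off [i0] totals
    t^2 - x_{i0}^2, which is at most 0 as x_{i0} >= t; so x_{i0} = t and every other square is b. No
    multiplicity of the eigenvalue r has to be determined. *)
Lemma is_S_energy_eq (r : nat) : is_S e r -> (E - t) ^+ 2 = (N - 1) * (X - t ^+ 2).
Proof.
move=> [a [arE [e_reg [nb_adj nb_nadj]]]].
have nb_a u v : u != v -> common_nb e u v = a.
  by move=> uv; case: (boolP (e u v)); [apply: nb_adj | apply: nb_nadj].
have tE : t = r%:R.
  apply: (mulfI (lt0r_neq0 N_gt0)); rewrite NtE /m /N -!natrM.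
  by rewrite (regular_nedges e_simple e_reg).
have XE : X = N * t.
  have mE : 2 * m = N * t by rewrite NtE.
  have -> : X = N * t + (M1 e)%:R - N * t ^+ 2.
    by rewrite /X /t; field; rewrite gt_eqF.
  by rewrite (regular_M1 e_reg) natrM natrX -tE -/N; ring.
have r_gt0 : (0 < r)%N by rewrite -(ltr_nat algR) -tE.
pose b : algR := t - a%:R.
(* The parameter relation a(n - 1) = r(r - 1), rewritten with r = t. *)
have bE : (N - 1) * b = N * t - t ^+ 2.
  have : (a * (n - 1))%:R = (r * (r - 1))%:R :> algR by rewrite arE.
  rewrite !natrM !natrB ?(ltnW vertices_gt1) // -tE -/N /b => arE'.
  by move: arE'; lra.
have x2 i : x i ^+ 2 = b \/ x i = t.
  by have := is_S_qeig e_simple e_reg nb_a i; rewrite -tE.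
have [i0 ge_t _] := max_qdev.
have t_ge1 : 1 <= t by rewrite tE -[1]/(1%:R) ler_nat.
have b_le : b <= t ^+ 2.
  have : 0 <= t * (t - 1) by rewrite mulr_ge0 ?subr_ge0 // ltW.
  have : 0 <= a%:R :> algR by [].
  by rewrite /b; lra.
have term_ge0 i : i != i0 -> 0 <= x i ^+ 2 - b.
  by move=> _; case: (x2 i) => ->; rewrite ?subrr // subr_ge0.
have sumE : \sum_(i | i != i0) (x i ^+ 2 - b) = t ^+ 2 - x i0 ^+ 2.
  rewrite sumrB sum_off XE sumr_const -[b *+ _]mulr_natl card_off bE; ring.
have x0_ge : t ^+ 2 <= x i0 ^+ 2.
  by rewrite ler_pXn2r ?nnegrE ?(le_trans (ltW t_gt0)) // ltW.
have sum0 : \sum_(i | i != i0) (x i ^+ 2 - b) = 0.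
  apply/eqP; rewrite eq_le sumr_ge0 // andbT sumE; move: x0_ge; lra.
have x0E : x i0 = t.
  apply/eqP; rewrite -(eqrXn2 (isT : (0 < 2)%N)) ?(le_trans (ltW t_gt0)) ?(ltW t_gt0) //.
  by move: sumE; rewrite sum0 => /esym/eqP; rewrite subr_eq0 eq_sym.
have xb i : i != i0 -> x i ^+ 2 = b.
  by move=> ii0; apply/eqP; rewrite -subr_eq0; apply/eqP; apply: (psumr_eq0P term_ge0 sum0).
rewrite (E_split ge_t) x0E subrr add0r XE -bE.
(* A second index exists because n > 1; it names the common norm off [i0]. *)
have [i1 i10] : exists i1, i1 != i0.
  apply/existsP; rewrite -[X in is_true X]negbK negb_exists; apply/negP => /forallP all_i0.
  have := vertices_gt1; rewrite -[n in (_ < n)%N]card_ord ltnNge => /negP; apply.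
  by apply/card_le1_eqP => i j _ _; have /negPn/eqP -> := all_i0 i;
    have /negPn/eqP -> := all_i0 j.
rewrite (eq_bigr (fun=> `|x i1|)); last first.
  by move=> i ii0; apply/eqP; rewrite -(eqrXn2 (isT : (0 < 2)%N)) //
    !real_normK ?num_real // !xb.
by rewrite sumr_const -[_ *+ #|_|]mulr_natl card_off exprMn
  real_normK ?num_real // xb // expr2 mulrA.
Qed.

End EnergyBounds.

Theorem mainTheorem13 (n : nat) (e : rel 'I_n) :
  simple_graph e -> (1 <= nedges e)%N ->
  let m : algC := (nedges e)%:R in
  let nn : algC := n%:R in
  let M : algC := (M1 e)%:R in
  let X : algC := 2 * m + M - 4 * m ^+ 2 / nn in
  (nn <= 8 * m ^+ 2 / (2 * m + M) ->
     QE e <= 2 * m / nn + sqrtC ((nn - 1) * (X - (2 * m / nn) ^+ 2)) /\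
     (QE e = 2 * m / nn + sqrtC ((nn - 1) * (X - (2 * m / nn) ^+ 2)) <->
        graph_iso e (@Kn n) \/
        (~~ odd n /\ graph_iso e (@matchingK2 n)) \/
        (exists r : nat, is_S e r)))
  /\
  (8 * m ^+ 2 / (2 * m + M) < nn ->
     QE e < sqrtC (X / nn) + sqrtC ((nn - 1) * (X - X / nn))).
Proof.
move=> e_simple m_gt0 m nn M X.
have n_gt0 : (0 < n)%N by rewrite ltnW // (vertices_gt1 e_simple).
pose N : algR := n%:R; pose mR : algR := (nedges e)%:R.
pose t : algR := 2 * mR / N.
pose XR : algR := 2 * mR + (M1 e)%:R - 4 * mR ^+ 2 / N.
pose E := \sum_i `|qdev e t i|.
have N_gt0 : 0 < N by rewrite ltr0n.
have den_gt0 : 0 < 2 * mR + (M1 e)%:R by rewrite ltr_wpDr ?ler0n // mulr_gt0 ?ltr0n.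
have nnE : nn = algRval N by rewrite rmorph_nat.
have tE : 2 * m / nn = algRval t by rewrite /t /mR /N fmorph_div rmorphM !rmorph_nat.
have XE : X = algRval XR.
  rewrite /XR /mR /N rmorphB rmorphD fmorph_div !rmorphM.
  by rewrite !rmorph_nat.
have QEE : QE e = algRval E.
  by rewrite QE_qeig //; congr algRval; apply: eq_bigr => i _; rewrite qdevE.
have thrE : 8 * m ^+ 2 / (2 * m + M) = algRval (8 * mR ^+ 2 / (2 * mR + (M1 e)%:R)).
  by rewrite /mR fmorph_div rmorphD !rmorphM !rmorph_nat.
(* The threshold on n is thereby the comparison of X with n t^2. *)
have XNt : XR - N * t ^+ 2 = (N * (2 * mR + (M1 e)%:R) - 8 * mR ^+ 2) / N.
  by rewrite /XR /t; field; rewrite gt_eqF.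
rewrite thrE tE XE nnE QEE; split=> [|lt_n].
  rewrite -/(N <= _) ler_pdivlMr // => le_n.
  have X_le : XR <= N * t ^+ 2.
    rewrite -subr_le0 XNt -[leRHS](mul0r N^-1) ler_pM2r ?invr_gt0 //.
    by rewrite subr_le0.
  have -> : (algRval N - 1) * (algRval XR - algRval t ^+ 2)
      = algRval ((N - 1) * (XR - t ^+ 2)).
    by [].
  have [le_sqrt eq_sqrt] := algRval_sqr_sqrtC ((N - 1) * (XR - t ^+ 2))
    (energy_ge_mean e_simple m_gt0).
  (* Removing t from both sides leaves the nonnegative E - t against a single square root. *)
  have shiftE : algRval E = algRval t + algRval (E - t) by rewrite -rmorphD addrC subrK.
  rewrite shiftE lerD2l; split; first exact: le_sqrt (energy_sub_mean_le _ _ X_le).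
  split=> [/addrI/eq_sqrt /(energy_eq_is_S e_simple m_gt0 X_le)|iso]; first by right; right.
  have [r e_S] : exists r, is_S e r.
    case: iso => [iso|[[n_even iso]|//]].
      by exists (n - 1)%N; apply: is_S_iso iso _; apply: Kn_is_S.
    by exists 1%N; apply: is_S_iso iso _; apply: matchingK2_is_S.
  by congr (_ + _); apply/eq_sqrt/(is_S_energy_eq e_simple m_gt0 e_S).
have X_gt : N * t ^+ 2 < XR.
  rewrite -subr_gt0 XNt divr_gt0 // subr_gt0 -ltr_pdivrMr //.
have E_ge0 : 0 <= E by apply: sumr_ge0.
have XR_ge0 : 0 <= XR by apply: le_trans (ltW X_gt); rewrite mulr_ge0 ?sqr_ge0 ?ltW.
pose s := sqrtC (algRval XR / algRval N).
have s2E : s ^+ 2 = algRval XR / algRval N by rewrite sqrtCK.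
have N1_ge0 : 0 <= algRval N - 1 by rewrite -nnE subr_ge0 -[1]/(1%:R) ler_nat.
have s_ge0 : 0 <= s by rewrite sqrtC_ge0; apply: divr_ge0; [exact: XR_ge0 | exact: (ltW N_gt0)].
have N_neq0 : algRval N != 0 by rewrite -nnE pnatr_eq0 -lt0n.
(* As X - X/n = (n - 1)X/n, the second root is (n - 1)s with s = sqrt(X/n), and the whole bound is
   ns. *)
have -> : (algRval N - 1) * (algRval XR - algRval XR / algRval N)
    = ((algRval N - 1) * s) ^+ 2.
  by rewrite exprMn s2E; move: (algRval N) (algRval XR) N_neq0 => a b a_neq0; field.
rewrite sqrCK ?mulr_ge0 // -/s.
have -> : s + (algRval N - 1) * s = algRval N * s by ring.
rewrite -(ltr_pXn2r (isT : (0 < 2)%N)) ?nnegrE ?mulr_ge0 //; last exact: ltW.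
have -> : (algRval N * s) ^+ 2 = algRval (N * XR).
  rewrite exprMn s2E [RHS](_ : _ = algRval N * algRval XR) //.
  by move: (algRval N) (algRval XR) N_neq0 => a b a_neq0; field.
by rewrite -rmorphXn; apply: (sqr_energy_lt e_simple m_gt0 X_gt).
Qed.
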